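(* Let $P_1,\dots,P_n$ be $d\times d$ permutation matrices and let $\mathcal S=\{(I\otimes P_i)|\Phi\rangle\}_{i=1}^n\subseteq\mathbb C^d\otimes\mathbb C^d$. Then the following statements are equivalent: (1) the states in $\mathcal S$ are perfectly distinguishable by one-way LOCC; (2) the states in $\mathcal S$ are perfectly distinguishable by arbitrary operations; (3) $\Delta(P_j^*P_i)=0$ whenever $i\neq j$. Moreover, if these conditions hold and $n=d$, then there exists a $d\times d$ Latin square $\mathcal L$ such that for all $i,j,k\in\{1,\dots,d\}$ the $(i,j)$ entry of $P_k$ is one if and only if the $(i,j)$ entry of $\mathcal L$ is $k$.
   Context: $|\Phi\rangle=\frac1{\sqrt d}\sum_{k=0}^{d-1}|k\rangle\otimes|k\rangle\in\mathbb C^d\otimes\mathbb C^d$ is the standard maximally entangled state; the first tensor factor is Alice's system, the second is Bob's. $\Delta$ is the linear map on square matrices which replaces all off-diagonal entries by zero and leaves the diagonal entries unchanged. A $d\times d$ Latin square is a $d\times d$ matrix with entries in $\{1,\dots,d\}$ such that no two entries in any row are equal and no two entries in any column are equal. A family of states (unit vectors) $|\psi_1\rangle,\dots,|\psi_n\rangle\in\mathbb C^d\otimes\mathbb C^d$ is perfectly distinguishable by one-way LOCC if there are finitely many positive semidefinite operators $A_k$ and $B_{k,j}$ ($1\le j\le n$) on $\mathbb C^d$ with $\sum_kA_k=I$ and $\sum_jB_{k,j}=I$ for each $k$, such that $\langle\psi_i|A_k\otimes B_{k,j}|\psi_i\rangle=0$ for all $k$ and all $i\neq j$. It is perfectly distinguishable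 by arbitrary operations if there are positive semidefinite operators $E_1,\dots,E_n$ on $\mathbb C^d\otimes\mathbb C^d$ with $\sum_jE_j=I$ and $\langle\psi_i|E_j|\psi_i\rangle=0$ for all $i\ne j$ (equivalently, the states are mutually orthogonal). *)

(* Defs.v *)
From mathcomp Require Import all_boot all_order all_algebra.
From mathcomp Require Import mxtens.

Set Implicit Arguments.
Unset Strict Implicit.
Unset Printing Implicit Defensive.

Import Order.TTheory GRing.Theory Num.Theory.
Local Open Scope ring_scope.

(* C^m (x) C^n is represented by 'cV_(m * n), with [*t] as tensor product both
   of vectors and of operators; for vectors this uses that 1 * 1 reduces to 1. *)

Section Defs.
Variable C : numClosedFieldType.

Definition adjmx m n (A : 'M[C]_(m, n)) : 'M[C]_(n, m) :=
  map_mx Num.conj A^T.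

(* <v| A |v> *)
Definition expval n (A : 'M[C]_n) (v : 'cV[C]_n) : C :=
  (adjmx v *m A *m v) 0 0.

(* [0 <= z] in C means that z is real and nonnegative; over C this forces A to
   be Hermitian. *)
Definition psdmx n (A : 'M[C]_n) : Prop :=
  forall v : 'cV[C]_n, 0 <= expval A v.

Definition ket n (k : 'I_n) : 'cV[C]_n := delta_mx k 0.

Definition max_entangled d : 'cV[C]_(d * d) :=
  (sqrtC d%:R)^-1 *: \sum_(k < d) (ket k *t ket k).

Definition diag_part n (A : 'M[C]_n) : 'M[C]_n :=
  \matrix_(i, j) (if i == j then A i j else 0).

Definition one_way_LOCC_distinguishable d n (psi : 'I_n -> 'cV[C]_(d * d)) :
    Prop :=
  exists (m : nat) (A : 'I_m -> 'M[C]_d) (B : 'I_m -> 'I_n -> 'M[C]_d),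
    [/\ forall k, psdmx (A k),
        forall k j, psdmx (B k j),
        \sum_k A k = 1%:M,
        forall k, \sum_j B k j = 1%:M
      & forall k i j, i != j -> expval (A k *t B k j) (psi i) = 0].

Definition distinguishable d n (psi : 'I_n -> 'cV[C]_(d * d)) : Prop :=
  exists E : 'I_n -> 'M[C]_(d * d),
    [/\ forall j, psdmx (E j),
        \sum_j E j = 1%:M
      & forall i j, i != j -> expval (E j) (psi i) = 0].

End Defs.

(* The symbols {1, ..., d} are represented by 'I_d. *)
Definition latin_square d (L : 'M['I_d]_d) : Prop :=
  (forall i, injective (fun j => L i j)) /\
  (forall j, injective (fun i => L i j)).

(* Main.v *)
(* <psi_j|psi_i> = tr(P_j^* P_i) / d, a sum of nonnegative diagonal entries, so
   orthogonality forces Delta(P_j^* P_i) = 0; perfect distinguishability forces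
   orthogonality because a positive semidefinite E with <v|E|v> = 0 kills v.
   Conversely, Delta(P_j^* P_i) = 0 says that P_i and P_j never agree on a basis
   vector, so both parties can measure in the computational basis.  When n = d,
   the permutations take d distinct values at each basis vector, hence every
   value exactly once, which gives the Latin square. *)

Require Import Defs.
From mathcomp Require Import all_boot all_order all_algebra.
From mathcomp Require Import fingroup perm spectral sesquilinear.
From mathcomp Require Import reals complex mxtens.

Import Order.TTheory GRing.Theory Num.Theory.
Local Open Scope ring_scope.
Local Open Scope complex_scope.

(** * Adjoints and Gram matrices *)

Lemma adjmxK (C : numClosedFieldType) m n (A : 'M[C]_(m, n)) :
  adjmx (adjmx A) = A.
Proof. by apply/matrixP => i j; rewrite !mxE conjCK. Qed.

Lemma adjmxM (C : numClosedFieldType) m n p (A : 'M[C]_(m, n))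
  (B : 'M[C]_(n, p)) : adjmx (A *m B) = adjmx B *m adjmx A.
Proof. by rewrite /adjmx trmx_mul map_mxM. Qed.

Lemma adjmxB (C : numClosedFieldType) m n (A B : 'M[C]_(m, n)) :
  adjmx (A - B) = adjmx A - adjmx B.
Proof. by rewrite /adjmx linearB map_mxB. Qed.

Lemma adjmx_tens (C : numClosedFieldType) m n p q (A : 'M[C]_(m, n))
  (B : 'M[C]_(p, q)) : adjmx (A *t B) = adjmx A *t adjmx B.
Proof. by rewrite /adjmx trmx_tens map_mxT. Qed.

Lemma adjmx_perm (C : numClosedFieldType) n (s : 'S_n) :
  adjmx (perm_mx s : 'M[C]_n) = perm_mx s^-1.
Proof. by rewrite /adjmx tr_perm_mx map_perm_mx. Qed.

Lemma expval_gram (C : numClosedFieldType) m n (M : 'M[C]_(m, n))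
    (v : 'cV[C]_n) :
  expval (adjmx M *m M) v = \sum_i `|(M *m v) i 0| ^+ 2.
Proof.
rewrite /expval !mulmxA -adjmxM -mulmxA mxE.
by apply: eq_bigr => i _; rewrite mxE [X in Num.conj X]mxE normCK mulrC.
Qed.

Lemma psdmx_gram (C : numClosedFieldType) m n (M : 'M[C]_(m, n)) :
  psdmx (adjmx M *m M).
Proof. by move=> v; rewrite expval_gram sumr_ge0 // => i _; rewrite exprn_ge0. Qed.

(** * Spectral theory of positive semidefinite matrices *)

Lemma expval_spectral (C : numClosedFieldType) n (A : 'M[C]_n) i :
  A \is normalmx ->
  spectral_diag A 0 i = expval A (adjmx (spectralmx A) *m ket C i).
Proof.
move=> /orthomx_spectralP A_eq; have U_unitary := spectral_unitarymx A.
have UV : spectralmx A *m adjmx (spectralmx A) = 1%:M by apply/unitarymxP.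
have VE : invmx (spectralmx A) = adjmx (spectralmx A) by rewrite invmx_unitary.
(* Writing A = U^* D U with U unitary, both products U U^* cancel and the (i, i) entry of D
   remains. *)
rewrite /expval {3}A_eq VE adjmxM adjmxK !mulmxA.
rewrite -(mulmxA _ (spectralmx A)) UV mulmx1.
rewrite -(mulmxA _ (spectralmx A)) UV mulmx1.
rewrite -mulmxA mxE (bigD1 i) //= big1 => [|j ji].
  by rewrite addr0 !mxE (bigD1 i) //= big1 => [|k ki];
    rewrite !mxE !eqxx /= ?conjC1 ?mul1r ?(negPf ki) ?mulr1n ?mulr1 ?addr0 ?mulr0.
by rewrite !mxE (negPf ji) conjC0 mul0r.
Qed.

Lemma normalmx_expval_eq0 (C : numClosedFieldType) n (A : 'M[C]_n) :
  A \is normalmx -> (forall v, expval A v = 0) -> A = 0.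
Proof.
move=> A_normal A0; have /orthomx_spectralP -> := A_normal.
suff -> : spectral_diag A = 0 by rewrite linear0 mulmx0 mul0mx.
by apply/rowP => i; rewrite expval_spectral // A0 mxE.
Qed.

Lemma expval_adjmx (C : numClosedFieldType) n (A : 'M[C]_n) v :
  expval (adjmx A) v = Num.conj (expval A v).
Proof.
have -> : Num.conj (expval A v) = adjmx (adjmx v *m A *m v) 0 0 
  by rewrite [RHS]mxE; congr Num.conj; rewrite [RHS]mxE.
by rewrite !adjmxM adjmxK mulmxA.
Qed.

(** A - A^* is anti-Hermitian, hence normal, and its expectation values z - conj z vanish because
    those of A are real. *)
Lemma psdmx_adj (C : numClosedFieldType) n (A : 'M[C]_n) :
  psdmx A -> adjmx A = A.
Proof.
move=> A_psd; apply/esym/eqP; rewrite -subr_eq0; apply/eqP.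
apply: normalmx_expval_eq0 => [|v].
  apply/normalmxP; rewrite -!/(adjmx _) adjmxB adjmxK.
  by rewrite -opprB mulmxN mulNmx.
rewrite /expval mulmxBr mulmxBl mxE [X in _ + X]mxE.
rewrite -/(expval A v) -/(expval (adjmx A) v) expval_adjmx.
by rewrite geC0_conj ?subrr // A_psd.
Qed.

(** With A = U^* D U and D nonnegative, M = sqrt(D) U works. *)
Lemma psdmx_factor (C : numClosedFieldType) n (A : 'M[C]_n) :
  psdmx A -> exists M : 'M[C]_n, A = adjmx M *m M.
Proof.
move=> A_psd.
have A_normal : A \is normalmx.
  by apply/normalmxP; rewrite -!/(adjmx _) psdmx_adj.
pose D := diag_mx (map_mx sqrtC (spectral_diag A)).
exists (D *m spectralmx A).
have /orthomx_spectralP {1}-> := A_normal.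
rewrite adjmxM -!mulmxA invmx_unitary ?spectral_unitarymx //; congr (_ *m _).
rewrite mulmxA; congr (_ *m _).
rewrite /adjmx tr_diag_mx map_diag_mx mulmx_diag; congr diag_mx.
apply/rowP => i; rewrite !mxE.
have d_ge0 : 0 <= spectral_diag A 0 i by rewrite expval_spectral.
by rewrite /= geC0_conj ?sqrtC_ge0 // -expr2 sqrtCK.
Qed.

(** For A = M^* M the expectation value is the squared norm of M v. *)
Lemma psdmx_expval_eq0 (C : numClosedFieldType) n (A : 'M[C]_n) v :
  psdmx A -> expval A v = 0 -> A *m v = 0.
Proof.
move=> /psdmx_factor[M ->]; rewrite expval_gram => /eqP.
rewrite psumr_eq0 => [/allP Mv0|i _]; last by rewrite exprn_ge0.
rewrite -mulmxA; suff -> : M *m v = 0 by rewrite mulmx0.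
apply/colP => i; rewrite [RHS]mxE; apply/eqP.
by have := Mv0 i (mem_index_enum i); rewrite expf_eq0 normr_eq0.
Qed.

(** * Sums and tensor products of operators *)

Lemma psdmx_tens (C : numClosedFieldType) m n (A : 'M[C]_m) (B : 'M[C]_n) :
  psdmx A -> psdmx B -> psdmx (A *t B).
Proof.
move=> /psdmx_factor[M ->] /psdmx_factor[N ->].
by rewrite -tensmx_mul -adjmx_tens; apply: psdmx_gram.
Qed.

Lemma expval_sum (C : numClosedFieldType) n (I : finType) (A : I -> 'M[C]_n) v :
  expval (\sum_k A k) v = \sum_k expval (A k) v.
Proof. by rewrite /expval mulmx_sumr mulmx_suml summxE. Qed.

Lemma psdmx_sum (C : numClosedFieldType) n (I : finType) (A : I -> 'M[C]_n) :
  (forall k, psdmx (A k)) -> psdmx (\sum_k A k).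
Proof. by move=> A_psd v; rewrite expval_sum sumr_ge0 // => k _; apply: A_psd. Qed.

Lemma tensmx_suml (R : pzRingType) m n p q (I : finType)
    (A : I -> 'M[R]_(m, n)) (B : 'M[R]_(p, q)) :
  \sum_k (A k *t B) = (\sum_k A k) *t B.
Proof.
apply/matrixP => i j; rewrite summxE !mxE summxE mulr_suml.
by apply: eq_bigr => k _; rewrite mxE.
Qed.

Lemma tensmx_sumr (R : pzRingType) m n p q (I : finType)
    (A : 'M[R]_(m, n)) (B : I -> 'M[R]_(p, q)) :
  \sum_k (A *t B k) = A *t (\sum_k B k).
Proof.
apply/matrixP => i j; rewrite summxE !mxE summxE mulr_sumr.
by apply: eq_bigr => k _; rewrite mxE.
Qed.

Lemma tens1mx1 (R : pzRingType) m n :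
  (1%:M : 'M[R]_m) *t (1%:M : 'M[R]_n) = 1%:M.
Proof.
apply/matrixP => i j; case: (mxtens_indexP i) => a b.
case: (mxtens_indexP j) => c e.
by rewrite tensmxE !mxE (can_eq (@mxtens_indexK m n)) xpair_eqE -natrM mulnb.
Qed.

Lemma sum_mxtens (V : nmodType) m n (F : 'I_(m * n) -> V) :
  \sum_k F k = \sum_a \sum_b F (mxtens_index (a, b)).
Proof.
rewrite pair_bigA (reindex (@mxtens_index m n)) /=; last first.
  by apply: onW_bij; exists (@mxtens_unindex m n);
    [apply: mxtens_indexK | apply: mxtens_unindexK].
by apply: eq_bigr => -[].
Qed.

(** * From LOCC to global measurements to orthogonality *)

Lemma distinguishable_of_one_way_LOCC (C : numClosedFieldType) d n
    (psi : 'I_n -> 'cV[C]_(d * d)) :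
  one_way_LOCC_distinguishable psi -> distinguishable psi.
Proof.
case=> m [A [B [A_psd B_psd A1 B1 AB0]]].
(* Forgetting Alice's outcome k yields a global measurement. *)
exists (fun j => \sum_k A k *t B k j); split.
- by move=> j; apply: psdmx_sum => k; apply: psdmx_tens.
- rewrite exchange_big /=.
  under eq_bigr => k _ do rewrite tensmx_sumr B1.
  by rewrite tensmx_suml A1 tens1mx1.
- by move=> i j ij; rewrite expval_sum big1 // => k _; apply: AB0.
Qed.

Lemma distinguishable_orthogonal (C : numClosedFieldType) d n
    (psi : 'I_n -> 'cV[C]_(d * d)) :
  distinguishable psi ->
  forall i j, i != j -> adjmx (psi j) *m psi i = 0.
Proof.
case=> E [E_psd E1 E0] i j ij.
(* Insert the sum of the E_k between the two states: E_k kills psi_i when k differs from i, while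
   E_i, being Hermitian, acts on the left and kills psi_j. *)
rewrite -[psi i]mul1mx -E1 mulmx_suml mulmx_sumr big1 // => k _.
have [->|ki] := eqVneq k i; last by rewrite psdmx_expval_eq0 ?mulmx0 ?E0 1?eq_sym.
rewrite -[E i]psdmx_adj // mulmxA -adjmxM psdmx_expval_eq0 ?E0 1?eq_sym //.
by rewrite /adjmx trmx0 map_mx0 mul0mx.
Qed.

(* Under C^d (x) C^d = 'M_d the state |Phi> is a multiple of the identity and
   A (x) B acts by X |-> B X A^T. *)
Lemma tens_max_entangledE (C : numClosedFieldType) d (A B : 'M[C]_d) a b :
  ((A *t B) *m max_entangled C d) (mxtens_index (a, b)) 0 =
    (sqrtC d%:R)^-1 * (B *m A^T) b a.
Proof.
rewrite /max_entangled -scalemxAr mxE; congr (_ * _).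
rewrite mulmx_sumr summxE mxE; apply: eq_bigr => k _.
rewrite (tensmx_mul A B (ket C k) (ket C k)) mxE mxtens_indexK /= !ord1 mulrC.
by rewrite -!colE !mxE.
Qed.

Lemma max_entangled_dot (C : numClosedFieldType) d (A B : 'M[C]_d) :
  (0 < d)%N ->
  (adjmx ((1%:M *t A) *m max_entangled C d) *m
     ((1%:M *t B) *m max_entangled C d)) 0 0 = d%:R^-1 * \tr (adjmx A *m B).
Proof.
move=> d_gt0; rewrite mxE sum_mxtens mulr_sumr; apply: eq_bigr => a _.
rewrite mxE mulr_sumr; apply: eq_bigr => b _.
have c_ge0 : 0 <= (sqrtC d%:R)^-1 :> C by rewrite invr_ge0 sqrtC_ge0 ler0n.
rewrite mxE [X in Num.conj X]mxE !tens_max_entangledE !trmx1 !mulmx1 !mxE.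
rewrite rmorphM /= geC0_conj // mulrACA -invfM -expr2 sqrtCK //.
Qed.

(** * Permutation matrices and the computational-basis protocol *)

Lemma diag_part_perm (C : numClosedFieldType) n (s t : 'S_n) :
  diag_part (adjmx (perm_mx t : 'M[C]_n) *m perm_mx s) = 0 <->
  (forall k, s k != t k).
Proof.
rewrite adjmx_perm -perm_mxM; split=> [/matrixP st k|st].
  (* The product is the matrix of x |-> s (t^-1 x), so its diagonal entry at t k is 1 exactly when s
     k = t k. *)
  have := st (t k) (t k); rewrite !mxE eqxx permM permK.
  by case: eqVneq => // _ /eqP; rewrite oner_eq0.
apply/matrixP => i j; rewrite !mxE; case: eqVneq => // <-.
by rewrite permM -{2}(permKV t i) (negPf (st _)).
Qed.

(** The diagonal entries are 0 or 1, so a vanishing trace kills each of them. *)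
Lemma trace_perm_eq0 (C : numClosedFieldType) n (s t : 'S_n) :
  \tr (adjmx (perm_mx t : 'M[C]_n) *m perm_mx s) = 0 ->
  diag_part (adjmx (perm_mx t : 'M[C]_n) *m perm_mx s) = 0.
Proof.
rewrite adjmx_perm -perm_mxM => /eqP.
rewrite psumr_eq0 => [/allP tr0|i _]; last by rewrite !mxE ler0n.
apply/matrixP => i j; rewrite mxE [RHS]mxE; case: eqVneq => // <-.
exact/eqP/tr0/mem_index_enum.
Qed.

Lemma psdmx_diag_bool (C : numClosedFieldType) n (f : 'I_n -> bool) :
  psdmx (diag_mx (\row_b (f b)%:R) : 'M[C]_n).
Proof.
(* A 0/1 diagonal matrix is a projection, hence its own Gram matrix. *)
suff <- : adjmx (diag_mx (\row_b (f b)%:R)) *m diag_mx (\row_b (f b)%:R) =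
          diag_mx (\row_b (f b)%:R) :> 'M[C]_n by apply: psdmx_gram.
rewrite /adjmx tr_diag_mx map_diag_mx mulmx_diag; congr diag_mx.
by apply/rowP => i; rewrite !mxE /= conjC_nat -natrM mulnb andbb.
Qed.

(* Alice measures in the computational basis.  On outcome k Bob holds P_i |k>,
   the basis vector e_b with s_i b = k; distinct i give distinct b, so he
   recovers i by measuring in the computational basis too.  The default i0 only
   serves to make his operators sum to the identity. *)
Lemma one_way_LOCC_perm (C : numClosedFieldType) d n (s : 'I_n -> 'S_d) :
  (0 < n)%N -> (forall i j, i != j -> forall b, s i b != s j b) ->
  one_way_LOCC_distinguishable
    (fun i => (1%:M *t perm_mx (s i)) *m max_entangled C d).
Proof.
move=> n_gt0 s_neq; pose i0 := Ordinal n_gt0.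
pose f k b := odflt i0 [pick i | s i b == k].
exists d, (fun k => delta_mx k k),
  (fun k j => diag_mx (\row_b (f k b == j)%:R)); split.
- move=> k; suff <- : adjmx (delta_mx k k) *m delta_mx k k = delta_mx k k :> 'M[C]_d
    by apply: psdmx_gram.
  by rewrite /adjmx trmx_delta map_delta_mx mul_delta_mx.
- by move=> k j; apply: psdmx_diag_bool.
- apply/matrixP => a b; rewrite summxE mxE (bigD1 a) //= big1 => [|k ka].
    by rewrite mxE eqxx addr0 eq_sym.
  by rewrite mxE eq_sym (negPf ka).
- move=> k; rewrite -linear_sum /= -[RHS]/(1%:M) -diag_const_mx; congr diag_mx.
  apply/rowP => b; rewrite summxE !mxE (bigD1 (f k b)) //= big1 => [|j jf].
    by rewrite mxE eqxx addr0.
  by rewrite mxE eq_sym (negPf jf).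
- move=> k i j ij; rewrite /expval -mulmxA (mulmxA (_ *t _)) tensmx_mul mulmx1.
  suff -> : (delta_mx k k *t (diag_mx (\row_b (f k b == j)%:R) *m perm_mx (s i)))
              *m max_entangled C d = 0 by rewrite mulmx0 mxE.
  apply/colP => x; case: (mxtens_indexP x) => a b.
  rewrite tens_max_entangledE [RHS]mxE; apply/eqP; rewrite mulf_eq0; apply/orP.
  right; rewrite trmx_delta mxE big1 // => c _; rewrite mul_diag_mx !mxE.
  case: (eqVneq c k) => [->|_]; last by rewrite mulr0.
  case: (eqVneq (s i b) k) => [sik|_]; last by rewrite mulr0 mul0r.
  (* Only c = k and s_i b = k survive; there i is the unique index that [pick] can return, so the
     indicator of [f k b == j] vanishes. *)
  suff -> : f k b = i by rewrite (negPf ij) !mul0r.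
  rewrite /f; case: pickP => [i' /eqP si'k /=|/(_ i)]; last by rewrite sik eqxx.
  by apply/eqP/negPn/negP => /s_neq/(_ b); rewrite sik si'k eqxx.
Qed.

(** * The Latin square and the conclusion *)

Lemma latin_square_perm d (s : 'I_d -> 'S_d) :
  (forall i j, i != j -> forall b, s i b != s j b) ->
  exists L : 'M['I_d]_d,
    latin_square L /\ forall i j k, s k i = j <-> L i j = k.
Proof.
move=> s_neq.
have s_inj i : injective (fun k => s k i).
  by move=> k l skl; apply/eqP/negPn/negP => /s_neq/(_ i); rewrite skl eqxx.
(* An injective self-map of a finite set is bijective, so each (i, j) has exactly one k with s_k i =
   j. *)
exists (\matrix_(i, j) invF (s_inj i) j).
have LE i j k : s k i = j <-> (\matrix_(i, j) invF (s_inj i) j) i j = k.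
  rewrite mxE; split=> [<-|<-]; first exact: (invF_f (s_inj i)).
  exact: (f_invF (s_inj i)).
(* Equal entries k in row i force j = s_k i = j'; in column j they force s_k i = s_k i', hence i =
   i'. *)
split=> //; split=> [i j j' | j i i'] /= /esym/LE.
  by have /LE -> := erefl ((\matrix_(i, j) invF (s_inj i) j) i j).
set k := _ i j => si'; have /LE : (\matrix_(i, j) invF (s_inj i) j) i j = k by [].
by rewrite -si' => /perm_inj.
Qed.

Theorem proposition2 (R : realType) (d n : nat) (d_gt0 : (0 < d)%N)
    (n_gt0 : (0 < n)%N) (P : 'I_n -> 'M[R[i]]_d)
    (P_perm : forall i, is_perm_mx (P i)) :
  let psi (i : 'I_n) : 'cV[R[i]]_(d * d) :=
    (1%:M *t P i) *m max_entangled R[i] d in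
  let cond1 := one_way_LOCC_distinguishable psi in
  let cond2 := distinguishable psi in
  let cond3 :=
    forall i j : 'I_n, i != j -> diag_part (adjmx (P j) *m P i) = 0 in
  [/\ cond1 <-> cond2,
      cond2 <-> cond3
    & [/\ cond1, cond2 & cond3] ->
      forall n_eq_d : n = d,
      exists L : 'M['I_d]_d,
        latin_square L /\
        forall i j k : 'I_d,
          P (cast_ord (esym n_eq_d) k) i j = 1 <-> L i j = k].
Proof.
move=> psi cond1 cond2 cond3.
have [s PE] : exists s : 'I_n -> 'S_d, forall i, P i = perm_mx (s i).
  by apply: (@fin_all_exists _ (fun=> _) (fun i t => P i = perm_mx t)) => i;
    apply/is_perm_mxP.
have c12 : cond1 -> cond2 by apply: distinguishable_of_one_way_LOCC.
have c23 : cond2 -> cond3.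
  move=> /distinguishable_orthogonal orth i j ij.
  (* The inner product is a trace divided by d, and d > 0 allows cancelling the factor. *)
  have /matrixP/(_ 0 0) := orth i j ij; rewrite max_entangled_dot // mxE !PE.
  move=> /eqP; rewrite mulf_eq0 invr_eq0 pnatr_eq0 eqn0Ngt d_gt0 /=.
  by move=> /eqP; apply: trace_perm_eq0.
have s_neq : cond3 -> forall i j, i != j -> forall b, s i b != s j b.
  by move=> c3 i j /c3; rewrite !PE => /diag_part_perm.
have c31 : cond3 -> cond1.
  move=> /s_neq/(one_way_LOCC_perm R[i] d n s n_gt0)[m [A [B [? ? ? ? AB0]]]].
  by exists m, A, B; split=> // k i j ij; rewrite /psi PE AB0.
(* Both equivalences follow from the cycle (1) => (2) => (3) => (1). *)
split; first by split=> [/c12|/c23/c31].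
  by split=> [/c23|/c31/c12].
(* Substituting d for n makes the index cast the identity. *)
move=> [_ _ /s_neq s_neq'] n_eq_d; subst n.
have [L [L_latin LE]] := latin_square_perm _ _ s_neq'.
exists L; split=> // i j k; rewrite cast_ord_id PE -LE !mxE.
split=> [|->]; last by rewrite eqxx.
by case: eqVneq => // _ /esym/eqP; rewrite oner_eq0.
Qed.
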